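(* Suppose that $F:\mathbb{R}^n\to\mathbb{R}^n$ is continuously differentiable on $\mathbb{R}^n$. Let $\{\eta_k\}$ be a positive sequence satisfying $\sum_{k=0}^\infty\eta_k<\eta<\infty$, and let $\{x_k\}$ be the sequence generated by the SRAND algorithm (described in the context) with parameter $\rho\in(0,1)$. Assume that $J_S(x^* )$ is positive definite at the limit point $x^*$ of $\{x_k\}$. Let $\sigma_{\max}(J(x^* ))$ be the largest singular value of $J(x^* )$. If, for some $\epsilon\in(0,1)$ and $\nu>0$, the two conditions $$\text{(A)}\quad \nu\ge\beta_k>\frac{\rho}{(1+\epsilon)\,\sigma_{\max}(J(x^* ))}\qquad\text{and}\qquad \text{(B)}\quad \beta_k\,q\big((G_S)_k,F_k\big)>\frac32\rho$$ hold for all sufficiently large $k$, then $F(x^* )=0$. If $\beta_k$ is either $\beta_{k,1}$ or $\beta_{k,2}$ (for all $k$ large enough), then only condition (B) has to be satisfied (for all $k$ large enough) to get $F(x^* )=0$. Moreover, for some $\omega_1,\omega_2\in(0,1)$, sufficient conditions for (B) to hold (for all $k$ large enough) are: 1. if $\beta_k=\beta_{k,1}$ for $k$ large enough: $\ \kappa(J_S(x^* ))<\dfrac{2\omega_1}{3\rho}$; 2. if $\beta_k=\beta_{k,2}$ for $k$ large enough: $\ \kappa(J_S(x^* ))<\omega_2\sqrt{\dfrac{2}{3\rho}}$; 3. if $J$ is symmetric and $\beta_k$ is either $\beta_{k,1}$ or $\beta_{k,2}$ for $k$ large enough: $\ \kappa(J(x^* ))<\dfrac{2\omega_1}{3\rho}$.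 Here $\kappa(\cdot)$ is the 2-norm condition number.
   Context: Notation: $\|\cdot\|$ is the Euclidean norm; $F_k=F(x_k)$; $J$ is the Jacobian matrix of $F$; for a square matrix $A$, $A_S=\frac12(A+A^T)$, so $J_S$ is the symmetric part of $J$. With $p_k=x_{k+1}-x_k$, $(G_S)_k=\int_0^1J_S(x_k+t\,p_k)\,dt$. The Rayleigh quotient of a symmetric matrix $M$ at a nonzero vector $p$ is $q(M,p)=\frac{p^TMp}{p^Tp}$. The two spectral steplengths are $$\beta_{k,1}=\frac{p_{k-1}^Tp_{k-1}}{p_{k-1}^Ty_{k-1}},\qquad \beta_{k,2}=\frac{p_{k-1}^Ty_{k-1}}{y_{k-1}^Ty_{k-1}},\qquad p_{k-1}=x_k-x_{k-1},\quad y_{k-1}=F_k-F_{k-1}.$$ SRAND algorithm. Given $x_0\in\mathbb{R}^n$, $0<\beta_{\min}<\beta_{\max}$, $\beta_0\in[\beta_{\min},\beta_{\max}]$, $\rho,\sigma\in(0,1)$ and a positive sequence $\{\eta_k\}$ with $\sum_k\eta_k<\eta<\infty$. If $\|F_0\|=0$ stop. For $k=0,1,2,\dots$: Step 1: set $\gamma=1$. Step 2: repeat: set $p_-=-\gamma\beta_kF_k$ and $p_+=\gamma\beta_kF_k$. Consider the linesearch conditions on a trial step $p$: (L1) $\|F(x_k+p)\|\le\big(1-\rho(1+\gamma)\big)\|F_k\|$, (L2) $\|F(x_k+p)\|\le(1+\eta_k-\rho\gamma)\|F_k\|$. If $p_-$ satisfies (L1), set $p_k=p_-$ and go to Step 3;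 else if $p_+$ satisfies (L1), set $p_k=p_+$ and go to Step 3; else if $p_-$ satisfies (L2), set $p_k=p_-$ and go to Step 3; else if $p_+$ satisfies (L2), set $p_k=p_+$ and go to Step 3; otherwise set $\gamma=\sigma\gamma$ and repeat Step 2. Step 3: set $\gamma_k=\gamma$, $x_{k+1}=x_k+p_k$. Step 4: if $\|F_{k+1}\|=0$ stop. Step 5: choose $\beta_{k+1}$ such that $|\beta_{k+1}|\in[\beta_{\min},\beta_{\max}]$. The choice of $\beta_{k+1}$ in Step 5 is otherwise arbitrary. The sequence $\{x_k\}$ considered is infinite (the algorithm does not stop, so $F_k\neq0$ for all $k$). It is a known property of the algorithm that, for any choice of the steplengths, $\{x_k\}$ is convergent; $x^*$ denotes its limit, and ''limit point'' refers to it. It is also known that $\{\|F_k\|\}$ converges and $\lim_{k\to\infty}\gamma_k\|F_k\|=0$. *)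

(* Defs.v *)
From mathcomp Require Export all_boot all_order all_algebra.
From mathcomp Require Export all_classical all_reals all_analysis.

Set Implicit Arguments.
Unset Strict Implicit.
Unset Printing Implicit Defensive.

Export Order.TTheory GRing.Theory Num.Theory.
Export numFieldNormedType.Exports.

Global Open Scope classical_set_scope.
Global Open Scope ring_scope.

(* Points of R^n are stored as row vectors, the type on which the library's
   Jacobian is defined. Matrices keep the usual column-vector meaning: A maps
   v to A v, that is, to v *m A^T in row storage. *)

Definition dot {R : realType} {n : nat} (u v : 'rV[R]_n) : R :=
  (u *m v^T) 0 0.

(* The library norm `|v| on row vectors is the sup norm. *)
Definition enorm {R : realType} {n : nat} (v : 'rV[R]_n) : R :=
  Num.sqrt (dot v v).

Definition appmx {R : realType} {n : nat} (A : 'M[R]_n) (v : 'rV[R]_n) :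
  'rV[R]_n := v *m A^T.

Definition sym_part {R : realType} {n : nat} (A : 'M[R]_n) : 'M[R]_n :=
  2^-1 *: (A + A^T).

Definition posdef {R : realType} {n : nat} (A : 'M[R]_n) : Prop :=
  forall v : 'rV[R]_n, v != 0 -> 0 < dot v (appmx A v).

Definition rayleigh {R : realType} {n : nat} (M : 'M[R]_n) (p : 'rV[R]_n) : R :=
  dot p (appmx M p) / dot p p.

Definition singular_values {R : realType} {n : nat} (A : 'M[R]_n) : set R :=
  [set s : R | 0 <= s /\ eigenvalue (A^T *m A) (s ^+ 2)].

(* The set of singular values is finite, and nonempty when n > 0, so that
   this supremum is a maximum. *)
Definition sigma_max {R : realType} {n : nat} (A : 'M[R]_n) : R :=
  sup (singular_values A).

Definition norm2_mx {R : realType} {n : nat} (A : 'M[R]_n) : R :=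
  sup [set enorm (appmx A v) | v in [set v : 'rV[R]_n | enorm v <= 1]].

(* Meaningful for invertible A only: invmx A is A when A is singular. *)
Definition cond2 {R : realType} {n : nat} (A : 'M[R]_n) : R :=
  norm2_mx A * norm2_mx (invmx A).

(* The library's 'J F x acts on the right of row vectors, so its (i, j) entry
   is the derivative of F_j with respect to x_i; hence the transpose. *)
Definition Jac {R : realType} {n : nat} (F : 'rV[R]_n -> 'rV[R]_n)
  (x : 'rV[R]_n) : 'M[R]_n := ('J F x)^T.

Definition JacS {R : realType} {n : nat} (F : 'rV[R]_n -> 'rV[R]_n)
  (x : 'rV[R]_n) : 'M[R]_n := sym_part (Jac F x).

Definition cont_diff {R : realType} {n : nat} (F : 'rV[R]_n -> 'rV[R]_n) :
  Prop := (forall x, differentiable F x) /\ continuous (Jac F).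

Section SRAND.
Context {R : realType} {n : nat}.
Variable F : 'rV[R]_n -> 'rV[R]_n.

Definition linesearch1 (rho gamma : R) (x p : 'rV[R]_n) : bool :=
  enorm (F (x + p)) <= (1 - rho * (1 + gamma)) * enorm (F x).

Definition linesearch2 (rho etak gamma : R) (x p : 'rV[R]_n) : bool :=
  enorm (F (x + p)) <= (1 + etak - rho * gamma) * enorm (F x).

(* One pass of Step 2; None means that gamma is to be reduced. *)
Definition try_step (rho etak betak gamma : R) (x : 'rV[R]_n) :
    option 'rV[R]_n :=
  let pm := - (gamma * betak) *: F x in
  let pp := (gamma * betak) *: F x in
  if linesearch1 rho gamma x pm then Some pm
  else if linesearch1 rho gamma x pp then Some pp
  else if linesearch2 rho etak gamma x pm then Some pm
  else if linesearch2 rho etak gamma x pp then Some pp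
  else None.

(* x and beta are the (infinite) sequences of iterates and of steplengths of
   a run that never stops; gamma_k is sigma ^+ m for the first m that is
   accepted. *)
Record SRAND_run (rho sigma beta_min beta_max eta : R)
    (eta_ : nat -> R) (beta : nat -> R) (x : nat -> 'rV[R]_n) : Prop := {
  srand_rho : 0 < rho < 1 ;
  srand_sigma : 0 < sigma < 1 ;
  srand_beta_bounds : 0 < beta_min < beta_max ;
  srand_eta_gt0 : forall k, 0 < eta_ k ;
  srand_eta_sum : (\sum_(0 <= k <oo) (eta_ k)%:E < eta%:E)%E ;
  srand_beta0 : beta_min <= beta 0%N <= beta_max ;
  srand_beta : forall k, beta_min <= `|beta k.+1| <= beta_max ;
  srand_nonstop : forall k, F (x k) != 0 ;
  srand_step : forall k, exists m : nat,
    (forall i, (i < m)%N ->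
       try_step rho (eta_ k) (beta k) (sigma ^+ i) (x k) = None) /\
    try_step rho (eta_ k) (beta k) (sigma ^+ m) (x k)
      = Some (x k.+1 - x k) }.

Variable x : nat -> 'rV[R]_n.

Definition GS (k : nat) : 'M[R]_n :=
  \matrix_(i < n, j < n)
    (\int[lebesgue_measure]_(t in `[0, 1])
       (JacS F (x k + t *: (x k.+1 - x k)) i j)).

(* The spectral steplengths beta_{k,1} and beta_{k,2}; only k > 0 is
   meaningful. *)
Definition bb1 (k : nat) : R :=
  let p := x k - x k.-1 in
  let y := F (x k) - F (x k.-1) in
  dot p p / dot p y.

Definition bb2 (k : nat) : R :=
  let p := x k - x k.-1 in
  let y := F (x k) - F (x k.-1) in
  dot p y / dot y y.

Definition condA (rho eps nu : R) (xstar : 'rV[R]_n) (beta : nat -> R)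
  (k : nat) : Prop :=
  nu >= beta k /\ beta k > rho / ((1 + eps) * sigma_max (Jac F xstar)).

Definition condB (rho : R) (beta : nat -> R) (k : nat) : Prop :=
  beta k * rayleigh (GS k) (F (x k)) > 3 / 2 * rho.

End SRAND.

(* Main.v *)
Require Import Defs.
From mathcomp Require Import ring lra.

Set Implicit Arguments.
Unset Strict Implicit.
Unset Printing Implicit Defensive.

(** Everything is a first-order comparison at the limit point z of the iterates,
    with J = Jac F z. Since F is continuously differentiable it is strictly
    differentiable at z: F b - F a = J (b - a) up to d |b - a| for a, b close to
    z ([cont_diff_strict]), and likewise the averaged matrix GS k has the same
    quadratic form as J up to d ([GS_near]).

    Vanishing of F at z ([srand_limit_zero]). Suppose F z <> 0. The steps
    x_(k+1) - x_k have norm gamma_k |beta_k| |F_k| and tend to 0, while |beta_k|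
    and |F_k| stay away from 0, so gamma_k tends to 0. Hence eventually the step
    was accepted only after a reduction of gamma, and the trial just before,
    p = - gamma beta_k F_k with gamma = gamma_k / sigma, was rejected by the
    second linesearch condition. Expanding |F (x_k + p)|^2 to first order, the
    rejection says beta_k q(J, F_k) < rho + o(1), because the beta_k are bounded
    ([rejected_backward_step]). Condition (B) says
    beta_k q(GS_k, F_k) > 3 rho / 2, and the two quotients differ by o(1), which
    is absurd since rho > 0.

    Sufficient conditions. Write A for the symmetric part of J,
    mu = 1 / |A^-1| and L = |A|, so that mu |v|^2 <= <v, J v> <= L |v|^2 for all
    v. No diagonalization enters: the lower bound is the Cauchy-Schwarz
    inequality of the form <u, A v> applied to v and A^-1 v. Then q(GS_k, F_k)
    is eventually at least mu - d, so (B) follows from a lower bound g on beta_k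
    with g mu > 3 rho / 2 ([condB_of_lower_bound]). As the secant pair p, y
    satisfies y = J p + o(|p|), the first steplength is at least 1 / L - o(1)
    ([bb1_lower_bound]); the second is at least mu / |J|^2 - o(1)
    ([bb2_lower_bound]), which explains the square root and the choice
    omega2 <= |A| / |J|; and when J is symmetric,
    |J p|^2 <= L <p, J p> improves the latter to 1 / L - o(1)
    ([bb2_sym_lower_bound]). The three o(1) are explicit functions of d, and
    [condB_of_secant_bound] turns continuity at d = 0 into the conclusion. *)

(** * Euclidean inner product and the action of matrices *)

Lemma dotE (R : realType) (n : nat) (u v : 'rV[R]_n) :
  dot u v = \sum_i u 0 i * v 0 i.
Proof. by rewrite /dot mxE; apply: eq_bigr => i _; rewrite mxE. Qed.

Lemma dotC (R : realType) (n : nat) (u v : 'rV[R]_n) : dot u v = dot v u.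
Proof. by rewrite !dotE; apply: eq_bigr => i _; rewrite mulrC. Qed.

Lemma dotDr (R : realType) (n : nat) (u v w : 'rV[R]_n) :
  dot u (v + w) = dot u v + dot u w.
Proof. by rewrite /dot linearD mulmxDr mxE. Qed.

Lemma dotZr (R : realType) (n : nat) (a : R) (u v : 'rV[R]_n) :
  dot u (a *: v) = a * dot u v.
Proof. by rewrite /dot linearZ /= -scalemxAr mxE. Qed.

Lemma dotBr (R : realType) (n : nat) (u v w : 'rV[R]_n) :
  dot u (v - w) = dot u v - dot u w.
Proof. by rewrite dotDr -(scaleN1r w) dotZr mulN1r. Qed.

Lemma dotDl (R : realType) (n : nat) (u v w : 'rV[R]_n) :
  dot (u + v) w = dot u w + dot v w.
Proof. by rewrite dotC dotDr !(dotC w). Qed.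

Lemma dotZl (R : realType) (n : nat) (a : R) (u v : 'rV[R]_n) :
  dot (a *: u) v = a * dot u v.
Proof. by rewrite dotC dotZr dotC. Qed.

Lemma dot0r (R : realType) (n : nat) (u : 'rV[R]_n) : dot u 0 = 0.
Proof. by rewrite /dot trmx0 mulmx0 mxE. Qed.

Lemma dot_ge0 (R : realType) (n : nat) (v : 'rV[R]_n) : 0 <= dot v v.
Proof. by rewrite dotE sumr_ge0 // => i _; rewrite -expr2 sqr_ge0. Qed.

Lemma le_entry_dot (R : realType) (n : nat) (v : 'rV[R]_n) (i : 'I_n) :
  v 0 i ^+ 2 <= dot v v.
Proof.
rewrite dotE (bigD1 i) //= -expr2 lerDl sumr_ge0 // => j _.
by rewrite -expr2 sqr_ge0.
Qed.

Lemma dot_gt0 (R : realType) (n : nat) (v : 'rV[R]_n) : v != 0 -> 0 < dot v v.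
Proof.
apply: contra_neqT; rewrite lt_neqAle dot_ge0 andbT negbK => /eqP v0.
apply/rowP => i; rewrite mxE; apply/eqP; rewrite -sqrf_eq0 eq_le sqr_ge0 andbT.
by rewrite v0 le_entry_dot.
Qed.

Lemma enorm_sqr (R : realType) (n : nat) (v : 'rV[R]_n) :
  enorm v ^+ 2 = dot v v.
Proof. by rewrite sqr_sqrtr ?dot_ge0. Qed.

Lemma enorm_ge0 (R : realType) (n : nat) (v : 'rV[R]_n) : 0 <= enorm v.
Proof. exact: sqrtr_ge0. Qed.

Lemma enorm_gt0 (R : realType) (n : nat) (v : 'rV[R]_n) :
  v != 0 -> 0 < enorm v.
Proof. by move=> v0; rewrite sqrtr_gt0 dot_gt0. Qed.

Lemma enorm0 (R : realType) (n : nat) : enorm (0 : 'rV[R]_n) = 0.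
Proof. by rewrite /enorm dot0r sqrtr0. Qed.

Lemma enormZ (R : realType) (n : nat) (a : R) (v : 'rV[R]_n) :
  enorm (a *: v) = `|a| * enorm v.
Proof.
rewrite /enorm dotZl dotZr mulrA -expr2 sqrtrM ?sqr_ge0 //.
by rewrite sqrtr_sqr.
Qed.

Lemma enorm_le (R : realType) (n : nat) (v : 'rV[R]_n) (c : R) :
  0 <= c -> dot v v <= c ^+ 2 -> enorm v <= c.
Proof.
move=> c0 vc; rewrite -(ler_pXn2r (n := 2)) ?nnegrE ?enorm_ge0 //.
by rewrite enorm_sqr.
Qed.

Lemma appmxE (R : realType) (n : nat) (A : 'M[R]_n) (v : 'rV[R]_n) (i : 'I_n) :
  appmx A v 0 i = \sum_j v 0 j * A i j.
Proof. by rewrite mxE; apply: eq_bigr => j _; rewrite mxE. Qed.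

Lemma appmxD (R : realType) (n : nat) (A : 'M[R]_n) (u v : 'rV[R]_n) :
  appmx A (u + v) = appmx A u + appmx A v.
Proof. exact: mulmxDl. Qed.

Lemma appmxZ (R : realType) (n : nat) (A : 'M[R]_n) (a : R) (v : 'rV[R]_n) :
  appmx A (a *: v) = a *: appmx A v.
Proof. by rewrite /appmx -scalemxAl. Qed.

Lemma appmxBl (R : realType) (n : nat) (A B : 'M[R]_n) (v : 'rV[R]_n) :
  appmx (A - B) v = appmx A v - appmx B v.
Proof. by rewrite /appmx linearB /= mulmxBr. Qed.

Lemma dot_appmx (R : realType) (n : nat) (A : 'M[R]_n) (u v : 'rV[R]_n) :
  dot u (appmx A v) = dot (appmx A^T u) v.
Proof. by rewrite /dot /appmx trmx_mul !trmxK mulmxA. Qed.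

Lemma sym_partE (R : realType) (n : nat) (A : 'M[R]_n) (i j : 'I_n) :
  sym_part A i j = 2^-1 * (A i j + A j i).
Proof. by rewrite !mxE. Qed.

Lemma sym_part_entry_near (R : realType) (n : nat) (A B : 'M[R]_n) (d : R)
    (i j : 'I_n) :
  `|A i j - B i j| <= d -> `|A j i - B j i| <= d ->
  `|sym_part A i j - sym_part B i j| <= d.
Proof.
rewrite !sym_partE !ler_norml => /andP[? ?] /andP[? ?].
by apply/andP; split; lra.
Qed.

Lemma subr_mxE (R : realType) (m n : nat) (A B : 'M[R]_(m, n)) (i : 'I_m)
    (j : 'I_n) :
  (A - B) i j = A i j - B i j.
Proof. by rewrite !mxE. Qed.

(** A matrix and its transpose have the same quadratic form. This is how the Jacobian
    and its symmetric part are exchanged throughout. *)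
Lemma dot_sym_part (R : realType) (n : nat) (A : 'M[R]_n) (v : 'rV[R]_n) :
  dot v (appmx (sym_part A) v) = dot v (appmx A v).
Proof.
have -> : appmx (sym_part A) v = 2^-1 *: (appmx A v + appmx A^T v).
  by rewrite /appmx /sym_part linearZ /= linearD /= -scalemxAr mulmxDr.
rewrite dotZr dotDr (dot_appmx A^T) trmxK (dotC _ v); lra.
Qed.

Lemma sym_part_tr (R : realType) (n : nat) (A : 'M[R]_n) :
  (sym_part A)^T = sym_part A.
Proof. by rewrite /sym_part linearZ linearD /= trmxK addrC. Qed.

Lemma sym_part_id (R : realType) (n : nat) (A : 'M[R]_n) :
  A^T = A -> sym_part A = A.
Proof.
by move=> At; rewrite /sym_part At -mulr2n -(scaler_nat 2 A) scalerA mulVf ?scale1r.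
Qed.

(** * Cauchy-Schwarz inequalities, operator norm and positive definiteness *)

(** The value at the vertex - b / c gives the bound when c > 0; for c = 0 the
    polynomial is affine, and for c < 0 it is negative far away. *)
Lemma discriminant_le (R : realType) (a b c : R) :
  (forall t, 0 <= a + 2 * t * b + t ^+ 2 * c) -> b ^+ 2 <= a * c.
Proof.
move=> h; have [c0|c0|c0] := ltgtP c 0.
- exfalso.
  have a0 : 0 <= a by have := h 0; rewrite mulr0 mul0r expr0n /= mul0r !addr0.
  (* Adding the values at t and - t cancels the linear term; t >= 1 makes
     t ^+ 2 * c at most t * c, which is already below - a. *)
  pose t := (a + 2 * b ^+ 2 + 1 - c) / - c.
  have h1 := h t; have h2 := h (- t).
  have tc : t * c = - (a + 2 * b ^+ 2 + 1 - c) by rewrite /t; field; rewrite lt_eqF.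
  have t1 : 1 <= t.
    rewrite /t ler_pdivlMr ?oppr_gt0 // mul1r; have := sqr_ge0 b; lra.
  have h3 : 0 <= a + t * (t * c) by rewrite mulrA -expr2; lra.
  rewrite tc in h3; have := sqr_ge0 b; nra.
- have := h (- b / c).
  have -> : a + 2 * (- b / c) * b + (- b / c) ^+ 2 * c = a - b ^+ 2 / c.
    by field; rewrite gt_eqF.
  by rewrite subr_ge0 ler_pdivrMr.
- rewrite c0 mulr0; have [->|b0] := eqVneq b 0; first by rewrite expr0n.
  have := h (- (a + 1) / (2 * b)); rewrite c0 mulr0 addr0.
  have -> : a + 2 * (- (a + 1) / (2 * b)) * b = - 1 by field.
  by rewrite oppr_ge0 real_leNgt ?num_real // ltr01.
Qed.

(** The quadratic form of A at u + t v is a nonnegative polynomial in t. *)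
Lemma psd_cauchy_schwarz (R : realType) (n : nat) (A : 'M[R]_n)
    (u v : 'rV[R]_n) :
  A^T = A -> (forall w, 0 <= dot w (appmx A w)) ->
  dot u (appmx A v) ^+ 2 <= dot u (appmx A u) * dot v (appmx A v).
Proof.
move=> At A0; apply: discriminant_le => t; have := A0 (u + t *: v).
rewrite appmxD appmxZ !dotDr !dotDl !dotZr !dotZl.
have -> : dot v (appmx A u) = dot u (appmx A v) by rewrite dot_appmx At dotC.
by congr (_ <= _); ring.
Qed.

Lemma cauchy_schwarz (R : realType) (n : nat) (u v : 'rV[R]_n) :
  `|dot u v| <= enorm u * enorm v.
Proof.
have e w : appmx 1%:M w = w :> 'rV[R]_n by rewrite /appmx trmx1 mulmx1.
have := @psd_cauchy_schwarz R n 1%:M u v (trmx1 _ _).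
rewrite !e => /(_ (fun w => _)) h.
have {}h : dot u v ^+ 2 <= dot u u * dot v v.
  by apply: h => w; rewrite e dot_ge0.
rewrite -(ler_pXn2r (n := 2)) ?nnegrE ?mulr_ge0 ?enorm_ge0 //.
by rewrite real_normK ?num_real // exprMn !enorm_sqr.
Qed.

Lemma enormD (R : realType) (n : nat) (u v : 'rV[R]_n) :
  enorm (u + v) <= enorm u + enorm v.
Proof.
apply: enorm_le; first by rewrite addr_ge0 ?enorm_ge0.
rewrite dotDl !dotDr (dotC v u) sqrrD !enorm_sqr.
have := le_trans (ler_norm _) (cauchy_schwarz u v); lra.
Qed.

(** The constant is far from optimal: the bound only serves to turn entrywise
    closeness into closeness of operators. *)
Lemma enorm_appmx_entry (R : realType) (n : nat) (A : 'M[R]_n) (d : R)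
    (v : 'rV[R]_n) :
  (forall i j, `|A i j| <= d) -> enorm (appmx A v) <= n%:R ^+ 2 * d * enorm v.
Proof.
case: n A v => [|n] A v Ad.
  by rewrite [appmx A v](_ : _ = 0) ?enorm0 ?expr0n ?mul0r //; apply/rowP => -[].
have d0 : 0 <= d by apply: le_trans (Ad 0 0).
have Av i : `|appmx A v 0 i| <= n.+1%:R * d * enorm v.
  rewrite /appmx mxE; apply: le_trans (ler_norm_sum _ _ _) _.
  rewrite -mulrA mulr_natl -[X in _ *+ X](card_ord n.+1) -sumr_const.
  apply: ler_sum => j _; rewrite mxE normrM mulrC ler_pM //.
  by rewrite -(sqrtr_sqr (v 0 j)) ler_wsqrtr ?le_entry_dot.
apply: enorm_le; first by rewrite !mulr_ge0 ?enorm_ge0.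
rewrite dotE; apply: (@le_trans _ _ (n.+1%:R * (n.+1%:R * d * enorm v) ^+ 2)).
  rewrite mulr_natl -[X in _ *+ X](card_ord n.+1) -sumr_const.
  apply: ler_sum => i _; rewrite -expr2 -(real_normK (num_real (_ i))).
  by rewrite ler_pXn2r ?nnegrE ?mulr_ge0 ?enorm_ge0.
have -> : (n.+1%:R ^+ 2 * d * enorm v) ^+ 2 =
          n.+1%:R ^+ 2 * (n.+1%:R * d * enorm v) ^+ 2 by ring.
rewrite ler_wpM2r ?sqr_ge0 // -natrX ler_nat expnS expn1.
by rewrite leq_pmulr.
Qed.

(** Scaling to the unit ball; the entrywise bound shows that the supremum defining
    the operator norm is taken over a bounded set. *)
Lemma enorm_appmx_norm2 (R : realType) (n : nat) (A : 'M[R]_n)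
    (v : 'rV[R]_n) : enorm (appmx A v) <= norm2_mx A * enorm v.
Proof.
have [->|v0] := eqVneq v 0.
  by rewrite enorm0 mulr0 /appmx mul0mx enorm0.
have nv := enorm_gt0 v0.
suff : enorm (appmx A ((enorm v)^-1 *: v)) <= norm2_mx A.
  rewrite appmxZ enormZ ger0_norm ?invr_ge0 ?enorm_ge0 // mulrC.
  by rewrite ler_pdivrMr.
apply: ub_le_sup; last first.
  exists ((enorm v)^-1 *: v) => //=.
  by rewrite enormZ ger0_norm ?invr_ge0 ?enorm_ge0 // mulVf ?gt_eqF.
(* Any bound on the entries will do; their total avoids a maximum. *)
pose d := \sum_i \sum_j `|A i j|.
exists (n%:R ^+ 2 * d) => _ [w /= w1 <-].
have Ad i j : `|A i j| <= d.
  rewrite /d (bigD1 i) //= (bigD1 j) //= -addrA lerDl addr_ge0 ?sumr_ge0 //.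
  by move=> k _; rewrite sumr_ge0.
have d0 : 0 <= d by rewrite sumr_ge0 // => i _; rewrite sumr_ge0.
apply: le_trans (enorm_appmx_entry w Ad) _.
by rewrite ler_piMr // mulr_ge0.
Qed.

Lemma dot_appmx_le_norm2 (R : realType) (n : nat) (A : 'M[R]_n)
    (v : 'rV[R]_n) : dot v (appmx A v) <= norm2_mx A * dot v v.
Proof.
apply: le_trans (le_trans (ler_norm _) (cauchy_schwarz _ _)) _.
rewrite -enorm_sqr expr2 mulrCA ler_wpM2l ?enorm_ge0 //.
exact: enorm_appmx_norm2.
Qed.

Lemma posdef_unitmx (R : realType) (n : nat) (A : 'M[R]_n) :
  posdef A -> A \in unitmx.
Proof.
move=> Apd; rewrite -unitmx_tr -row_free_unit -kermx_eq0.
apply: contraT => /rowV0Pn[v /sub_kermxP vA v0].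
by have := Apd v v0; rewrite /appmx vA dot0r ltxx.
Qed.

Lemma posdef_psd (R : realType) (n : nat) (A : 'M[R]_n) (v : 'rV[R]_n) :
  posdef A -> 0 <= dot v (appmx A v).
Proof.
move=> Apd; have [->|v0] := eqVneq v 0; last exact/ltW/Apd.
by rewrite /appmx mul0mx dot_ge0.
Qed.

(** With w = A v, Cauchy-Schwarz for the form of A gives
    |w|^4 = <w, A v>^2 <= <w, A w> <v, A v> <= |A| |w|^2 <v, A v>. *)
Lemma sqr_enorm_appmx_le (R : realType) (n : nat) (A : 'M[R]_n)
    (v : 'rV[R]_n) : A^T = A -> posdef A ->
  dot (appmx A v) (appmx A v) <= norm2_mx A * dot v (appmx A v).
Proof.
move=> At Apd; set w := appmx A v.
have [w0|w0] := eqVneq w 0.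
  by rewrite w0 !dot0r mulr0.
have := @psd_cauchy_schwarz R n A w v At (fun u => posdef_psd u Apd).
rewrite -/w expr2 => h.
rewrite -(ler_pM2l (dot_gt0 w0)); apply: le_trans h _.
rewrite mulrA [X in _ <= X * _]mulrC ler_wpM2r //; first exact: posdef_psd.
exact: dot_appmx_le_norm2.
Qed.

(** The smallest eigenvalue of A is 1 / |A^-1|: with A w = v, Cauchy-Schwarz for
    the form of A gives |v|^4 = <v, A w>^2 <= <v, A v> <w, A w>, and
    <w, A w> = <v, A^-1 v> <= |A^-1| |v|^2. *)
Lemma posdef_ge_norm2_inv (R : realType) (n : nat) (A : 'M[R]_n)
    (v : 'rV[R]_n) : A^T = A -> posdef A ->
  dot v v <= norm2_mx (invmx A) * dot v (appmx A v).
Proof.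
move=> At Apd; have uA := posdef_unitmx Apd.
have [->|v0] := eqVneq v 0.
  by rewrite /appmx mul0mx !dot0r mulr0.
pose w := appmx (invmx A) v.
have Aw : appmx A w = v by rewrite /w /appmx trmx_inv mulmxKV // unitmx_tr.
have := @psd_cauchy_schwarz R n A v w At (fun u => posdef_psd u Apd).
rewrite Aw expr2 (dotC w) => h.
rewrite -(ler_pM2l (dot_gt0 v0)); apply: le_trans h _.
rewrite mulrC mulrA [X in _ <= X * _]mulrC ler_wpM2r //.
  exact: posdef_psd.
exact: dot_appmx_le_norm2.
Qed.

(** * Mean values of the Jacobian near a point *)

Lemma Jac_entry_near (R : realType) (n : nat) (F : 'rV[R]_n -> 'rV[R]_n)
    (z : 'rV[R]_n) (d : R) : cont_diff F -> 0 < d ->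
  exists2 r : R, 0 < r & forall w, `|w - z| < r ->
    forall i j, `|Jac F w i j - Jac F z i j| <= d.
Proof.
move=> [_ Jc] d0.
have /nbhs_normP[r /= r0 rP] : \forall w \near z, ball (Jac F z) d (Jac F w).
  by apply: Jc; exact: nbhsx_ballx.
exists r => // w wr i j; have zw : `|z - w| < r by rewrite distrC.
have [_ /(_ i j) h] := rP w zw.
have {}h : `|Jac F z i j - Jac F w i j| < d := h.
by rewrite (distrC (Jac F w i j)) ltW.
Qed.

Lemma segment_dist_lt (R : realType) (n : nat) (z a b : 'rV[R]_n) (r t : R) :
  `|a - z| < r -> `|b - z| < r -> 0 <= t <= 1 ->
  `|a + t *: (b - a) - z| < r.
Proof.
move=> ar br /andP[t0 t1].
have -> : a + t *: (b - a) - z = (1 - t) *: (a - z) + t *: (b - z).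
  by rewrite scalerBl scale1r !scalerBr; apply/rowP => i; rewrite !mxE; ring.
apply: le_lt_trans (ler_normD _ _) _; rewrite !normrZ !ger0_norm ?subr_ge0 //.
have [->|tn0] := eqVneq t 0; first by rewrite subr0 mul1r mul0r addr0.
have : 0 < t by rewrite lt_neqAle eq_sym tn0.
by move=> tp; nra.
Qed.

(** The chain rule along a line, read in one coordinate. *)
Lemma coord_line_is_derive (R : realType) (n : nat)
    (F : 'rV[R]_n -> 'rV[R]_n) (a p : 'rV[R]_n) (i : 'I_n) (t : R) :
  differentiable F (a + t *: p) ->
  is_derive t 1 (fun s : R => F (a + s *: p) 0 i)
    (appmx (Jac F (a + t *: p)) p 0 i).
Proof.
move=> dF; set l := fun s : R => a + s *: p.
have dl : differentiable l t by apply: differentiableD.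
have dFl : differentiable (F \o l) t by exact: differentiable_comp.
have dl1 : 'd l t 1 = p.
  have h := is_diffD (is_diff_cst a t) (is_diff_scalel t p).
  by have := @diff_val _ _ _ _ _ _ _ h => /(congr1 (@^~ 1)) /= ->;
    rewrite /= [LHS]add0r scale1r.
have dv : derivable (F \o l) t 1 by exact: diff_derivable.
apply: DeriveDef; first exact: (derivable_mxP (F \o l) t 1).1 dv 0 i.
have -> : appmx (Jac F (a + t *: p)) p = 'D_1 (F \o l) t.
  rewrite deriveE // diff_comp //= dl1 -deriveE // deriveEjacobian //.
  by rewrite /appmx /Jac trmxK.
by rewrite derive_mx // mxE.
Qed.

(** The mean value theorem fails for vector-valued maps, but holds for each
    coordinate; the i-th row of the Jacobian is therefore taken at its own point
    of the segment. *)
Lemma mean_value_rows (R : realType) (n : nat) (F : 'rV[R]_n -> 'rV[R]_n)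
    (a b : 'rV[R]_n) : (forall z, differentiable F z) ->
  exists2 t : 'I_n -> R, forall i, 0 <= t i <= 1 &
    F b - F a =
    appmx (\matrix_(i, j) Jac F (a + t i *: (b - a)) i j) (b - a).
Proof.
move=> dF.
have mv i : exists s : R, 0 <= s <= 1 /\
    F b 0 i - F a 0 i = appmx (Jac F (a + s *: (b - a))) (b - a) 0 i.
  have [||c c01] := @MVT R (fun s : R => F (a + s *: (b - a)) 0 i)
    (fun s => appmx (Jac F (a + s *: (b - a))) (b - a) 0 i) 0 1 ltr01.
  - by move=> s _; exact: coord_line_is_derive.
  - apply: continuous_subspaceT => s.
    apply: differentiable_continuous; apply/derivable1_diffP.
    exact: (@ex_derive _ _ _ _ _ _ _ (coord_line_is_derive i (dF _))).
  rewrite scale1r scale0r addr0 (addrC a) subrK subr0 mulr1 => e.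
  exists c; split=> //.
  by move: c01; rewrite in_itv /= => /andP[/ltW -> /ltW ->].
have [t tP] := choice mv.
exists t => [i|]; first by case: (tP i).
apply/rowP => i; have [_ e] := tP i.
rewrite subr_mxE e !appmxE; apply: eq_bigr => j _.
by rewrite [in RHS]mxE.
Qed.

(** Strict differentiability at z: the linear approximation by the Jacobian at z is
    uniform over pairs of points near z, unlike in plain differentiability where
    one point is z itself. *)
Lemma cont_diff_strict (R : realType) (n : nat) (F : 'rV[R]_n -> 'rV[R]_n)
    (z : 'rV[R]_n) (d : R) : cont_diff F -> 0 < d ->
  exists2 r : R, 0 < r & forall a b, `|a - z| < r -> `|b - z| < r ->
    enorm (F b - F a - appmx (Jac F z) (b - a)) <= d * enorm (b - a).
Proof.
move=> FC d0.
(* The factor n ^ 2 is lost when passing from entries to the operator; the 1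
   keeps the denominator positive for n = 0. *)
have c0 : 0 < n%:R ^+ 2 + 1 :> R by rewrite ltr_wpDl ?sqr_ge0.
have [r r0 rP] := Jac_entry_near z FC (divr_gt0 d0 c0).
exists r => // a b ar br; have [t t01 ->] := mean_value_rows a b (proj1 FC).
rewrite -appmxBl; set M := (_ - _ : 'M[R]_n).
have Md i j : `|M i j| <= d / (n%:R ^+ 2 + 1).
  rewrite /M subr_mxE [X in `|X - _|]mxE.
  exact: rP (segment_dist_lt ar br (t01 i)) _ _.
apply: le_trans (enorm_appmx_entry _ Md) _.
rewrite ler_wpM2r ?enorm_ge0 // mulrA ler_pdivrMr // mulrC ler_wpM2l ?ltW //.
by rewrite ltrDl.
Qed.

Lemma Rintegral01_near (R : realType) (f : R -> R) (c d : R) :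
  continuous f -> (forall t, 0 <= t <= 1 -> `|f t - c| <= d) ->
  `|\int[lebesgue_measure]_(t in `[0, 1]) f t - c| <= d.
Proof.
move=> fc fd.
have mI : measurable (`[0, 1]%classic : set (measurableTypeR R)) by [].
have I01 (g : R -> R) : continuous g ->
    lebesgue_measure.-integrable `[0, 1] (EFin \o g).
  move=> gc; apply: continuous_compact_integrable; first exact: segment_compact.
  exact: continuous_subspaceT.
have icst e : \int[lebesgue_measure]_(t in `[0, 1]) e = e :> R.
  rewrite Rintegral_cst //= lebesgue_measure_itv /= lte_fin ltr01.
  by rewrite -EFinB subr0 /= mulr1.
have cc (e : R) : continuous (fun _ : R => e) by move=> ?; exact: cvg_cst.
rewrite ler_norml lerBrDr lerBlDr; apply/andP; split.
  rewrite -[leLHS]icst; apply: le_Rintegral => //; [exact: I01|exact: I01|].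
  move=> t; rewrite /= in_itv /= => /fd; rewrite ler_norml => /andP[]; lra.
rewrite -[leRHS]icst; apply: le_Rintegral => //; [exact: I01|exact: I01|].
move=> t; rewrite /= in_itv /= => /fd; rewrite ler_norml => /andP[]; lra.
Qed.

Lemma JacS_line_continuous (R : realType) (n : nat)
    (F : 'rV[R]_n -> 'rV[R]_n) (a p : 'rV[R]_n) (i j : 'I_n) :
  cont_diff F -> continuous (fun t : R => JacS F (a + t *: p) i j).
Proof.
move=> [_ Jc] t.
have lc : {for t, continuous (fun s : R => a + s *: p)}.
  by apply: cvgD; [exact: cvg_cst|apply: scalel_continuous].
have Jij k l : (fun s : R => Jac F (a + s *: p) k l) @ t -->
    Jac F (a + t *: p) k l.
  apply: (@continuous_comp _ _ _ (fun s : R => Jac F (a + s *: p))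
    (fun M : 'M[R]_n => M k l)); last exact: coord_continuous.
  by apply: (@continuous_comp _ _ _ (fun s : R => a + s *: p) (Jac F));
    [exact: lc|exact: Jc].
have -> : (fun s : R => JacS F (a + s *: p) i j) =
    (fun s : R => 2^-1 * (Jac F (a + s *: p) i j + Jac F (a + s *: p) j i)).
  by apply/funext => s; rewrite /JacS sym_partE.
by apply: cvgMr; apply: cvgD; exact: Jij.
Qed.

(** The entries of the averaged symmetric Jacobian are averages over segments
    that shrink to z. *)
Lemma GS_near (R : realType) (n : nat) (F : 'rV[R]_n -> 'rV[R]_n)
    (z : 'rV[R]_n) (x : nat -> 'rV[R]_n) (d : R) :
  cont_diff F -> x @ \oo --> z -> 0 < d ->
  \forall k \near \oo, forall v,
    `|dot v (appmx (GS F x k) v) - dot v (appmx (Jac F z) v)| <= d * dot v v.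
Proof.
move=> FC xz d0.
have c0 : 0 < n%:R ^+ 2 + 1 :> R by rewrite ltr_wpDl ?sqr_ge0.
have [r r0 rP] := Jac_entry_near z FC (divr_gt0 d0 c0).
have xr : \forall k \near \oo, `|x k - z| < r.
  by move/cvgr_distC_lt : xz; apply.
have xr' : \forall k \near \oo, `|x k.+1 - z| < r.
  by move: xz; rewrite -(cvg_shiftS x) => /cvgr_distC_lt; apply.
near=> k => v.
have kr : `|x k - z| < r by near: k.
have kr' : `|x k.+1 - z| < r by near: k.
rewrite -(dot_sym_part (Jac F z)) -/(JacS F z).
have -> : dot v (appmx (GS F x k) v) - dot v (appmx (JacS F z) v) =
    dot v (appmx (GS F x k - JacS F z) v).
  by rewrite appmxBl dotBr.
set M := (_ - _ : 'M[R]_n).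
have Md i j : `|M i j| <= d / (n%:R ^+ 2 + 1).
  rewrite /M subr_mxE /GS [X in `|X - _|]mxE; apply: Rintegral01_near.
    exact: JacS_line_continuous.
  move=> t t01; have wP := rP _ (segment_dist_lt kr kr' t01).
  exact: sym_part_entry_near (wP i j) (wP j i).
apply: le_trans (cauchy_schwarz _ _) _.
rewrite -enorm_sqr expr2 mulrCA ler_wpM2l ?enorm_ge0 //.
apply: le_trans (enorm_appmx_entry _ Md) _.
rewrite ler_wpM2r ?enorm_ge0 // mulrA ler_pdivrMr // mulrC ler_wpM2l ?ltW //.
by rewrite ltrDl.
Unshelve. all: by end_near.
Qed.

(** * Rejected trial steps and the vanishing of F at the limit *)

Lemma srand_beta_abs (R : realType) (n : nat) (F : 'rV[R]_n -> 'rV[R]_n)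
    (rho sigma beta_min beta_max eta : R) (eta_ beta : nat -> R)
    (x : nat -> 'rV[R]_n) (k : nat) :
  SRAND_run F rho sigma beta_min beta_max eta eta_ beta x ->
  beta_min <= `|beta k| <= beta_max.
Proof.
case=> _ _ /andP[b0 _] _ _ /andP[bl bu] bS _ _; case: k => [|k]; last exact: bS.
by rewrite ger0_norm ?bl ?bu // (le_trans (ltW b0) bl).
Qed.

Lemma try_step_some (R : realType) (n : nat) (F : 'rV[R]_n -> 'rV[R]_n)
    (rho etak betak gamma : R) (x p : 'rV[R]_n) :
  try_step F rho etak betak gamma x = Some p ->
  p = - (gamma * betak) *: F x \/ p = (gamma * betak) *: F x.
Proof.
by rewrite /try_step; do 4?[case: ifP => _]; move=> // -[<-]; [left|right|left|right].
Qed.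

(** A reduction of gamma means in particular that the backward step fails the
    second, weaker, linesearch condition. *)
Lemma try_step_none (R : realType) (n : nat) (F : 'rV[R]_n -> 'rV[R]_n)
    (rho etak betak gamma : R) (x : 'rV[R]_n) :
  try_step F rho etak betak gamma x = None ->
  (1 + etak - rho * gamma) * enorm (F x) <
  enorm (F (x + - (gamma * betak) *: F x)).
Proof.
rewrite /try_step; case: ifP => // _; case: ifP => // _; case: ifP => //.
by rewrite /linesearch2 => /negbT; rewrite -ltNge.
Qed.

Lemma srand_step_neq0 (R : realType) (n : nat) (F : 'rV[R]_n -> 'rV[R]_n)
    (rho sigma beta_min beta_max eta : R) (eta_ beta : nat -> R)
    (x : nat -> 'rV[R]_n) (k : nat) :
  SRAND_run F rho sigma beta_min beta_max eta eta_ beta x ->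
  x k.+1 - x k != 0.
Proof.
move=> run; have /andP[bl _] := srand_beta_abs k run.
case: run => _ /andP[s0 _] /andP[b0 _] _ _ _ _ Fn st.
have [m [_ /try_step_some sm]] := st k.
have bk : beta k != 0 by rewrite -normr_gt0 (lt_le_trans b0 bl).
have c0 : sigma ^+ m * beta k != 0 by rewrite mulf_neq0 // expf_neq0 ?gt_eqF.
by case: sm => ->; rewrite scaler_eq0 ?oppr_eq0 negb_or c0 Fn.
Qed.

(** Here f is the current value, y the change of F along the trial step
    p = - gamma b f and A the Jacobian at the limit. Squaring the rejection and
    expanding |f + y|^2 gives
    (1 - 2 rho gamma) |f|^2 < |f|^2 + 2 <f, y> + |y|^2; dividing by 2 gamma
    leaves the quadratic form of A, the error d |b| of the linearization, and
    the second-order term |y|^2 / (2 gamma). *)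
Lemma rejected_backward_step (R : realType) (n : nat) (A : 'M[R]_n)
    (f y : 'rV[R]_n) (rho gamma b d : R) :
  f != 0 -> 0 < rho < 1 -> 0 < gamma <= 1 -> 0 <= d ->
  enorm (y - appmx A (- (gamma * b) *: f)) <=
    d * enorm (- (gamma * b) *: f) ->
  (1 - rho * gamma) * enorm f < enorm (f + y) ->
  b * dot f (appmx A f) <
  (rho + d * `|b| + gamma * b ^+ 2 * (norm2_mx A + d) ^+ 2 / 2) * dot f f.
Proof.
move=> f0 /andP[r0 r1] /andP[g0 g1] d0; set p := _ *: f => ye rej.
have np : enorm p = gamma * `|b| * enorm f.
  by rewrite /p enormZ normrN normrM (gtr0_norm g0).
have N0 := dot_gt0 f0.
have ef0 := enorm_ge0 f.
set e := y - appmx A p in ye.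
have yE : y = appmx A p + e by rewrite /e addrC subrK.
have fe : dot f e <= d * (gamma * `|b|) * dot f f.
  apply: le_trans (le_trans (ler_norm _) (cauchy_schwarz _ _)) _.
  rewrite -enorm_sqr expr2 mulrA [X in _ <= X]mulrC ler_wpM2l //.
  by rewrite -mulrA -np.
have fAp : dot f (appmx A p) = - (gamma * b * dot f (appmx A f)).
  by rewrite /p appmxZ dotZr mulNr.
have yn : enorm y <= (norm2_mx A + d) * enorm p.
  rewrite yE mulrDl; apply: le_trans (enormD _ _) _.
  by rewrite lerD // enorm_appmx_norm2.
have yy : dot y y <= (norm2_mx A + d) ^+ 2 * (gamma ^+ 2 * b ^+ 2) * dot f f.
  rewrite -!enorm_sqr; have -> : (norm2_mx A + d) ^+ 2 * (gamma ^+ 2 * b ^+ 2) *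
      enorm f ^+ 2 = ((norm2_mx A + d) * enorm p) ^+ 2.
    by rewrite np !exprMn real_normK ?num_real // !mulrA.
  by rewrite ler_pXn2r ?nnegrE ?enorm_ge0 // (le_trans (enorm_ge0 y) yn).
have sq : (1 - rho * gamma) ^+ 2 * dot f f < dot f f + 2 * dot f y + dot y y.
  have -> : dot f f + 2 * dot f y + dot y y = enorm (f + y) ^+ 2.
    by rewrite enorm_sqr dotDl !dotDr (dotC y f); ring.
  rewrite -enorm_sqr -exprMn ltr_pXn2r ?nnegrE ?enorm_ge0 //.
  by rewrite mulr_ge0 // subr_ge0; nra.
have fy : dot f y = - (gamma * b * dot f (appmx A f)) + dot f e.
  by rewrite yE dotDr fAp.
move: sq yy fe; rewrite fy.
move: (dot f (appmx A f)) (dot f e) (dot y y) (norm2_mx A) N0 => q c w S.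
move: (dot f f) (`|b|) => N ab N0 sq yy fe.
rewrite -(ltr_pM2l g0).
have : 0 <= rho ^+ 2 * gamma ^+ 2 * N by rewrite !mulr_ge0 ?sqr_ge0 // ltW.
lra.
Qed.

(** The rejection bounds b q / N by rho from above, condition (B) bounds b qG / N by
    3 rho / 2 from below; the gap rho / 2 must be absorbed by the error terms. *)
Lemma rejection_condB_gap (R : realType) (b q qG N rho d gam S : R) :
  0 < N -> `|qG - q| <= d * N ->
  b * q < (rho + d * `|b| + gam * b ^+ 2 * S / 2) * N ->
  3 / 2 * rho < b * (qG / N) ->
  rho < 4 * d * `|b| + gam * b ^+ 2 * S.
Proof.
move=> N0 qd h; rewrite mulrA ltr_pdivlMr // => h2.
have h3 : b * qG - b * q <= `|b| * (d * N).
  rewrite -mulrBr; apply: le_trans (ler_norm _) _.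
  by rewrite normrM ler_wpM2l.
rewrite -(ltr_pM2r N0); lra.
Qed.

(** The tolerance d and the bound g on the rejected gamma are chosen so that each of
    the two error terms of [rejection_condB_gap] is at most rho / 2. *)
Lemma srand_limit_zero (R : realType) (n : nat) (F : 'rV[R]_n -> 'rV[R]_n)
    (z : 'rV[R]_n) (rho sigma beta_min beta_max eta : R)
    (eta_ beta : nat -> R) (x : nat -> 'rV[R]_n) :
  cont_diff F -> SRAND_run F rho sigma beta_min beta_max eta eta_ beta x ->
  x @ \oo --> z -> (\forall k \near \oo, condB F x rho beta k) -> F z = 0.
Proof.
move=> FC run xz Bk; apply/eqP/negP => /negP Fz.
have babs k := srand_beta_abs k run.
have [/andP[rho0 rho1] /andP[s0 s1] /andP[bm0 bmM] eta0 _ _ _ Fn st] := run.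
have bM0 : 0 < beta_max by apply: lt_trans bmM.
pose d := rho / (8 * beta_max).
have d0 : 0 < d by rewrite divr_gt0 // mulr_gt0.
pose S := (norm2_mx (Jac F z) + d) ^+ 2.
have S0 : 0 <= S by rewrite sqr_ge0.
pose C := beta_max ^+ 2 * S.
have C0 : 0 <= C by rewrite mulr_ge0 ?sqr_ge0.
pose g := Num.min 1 (rho / (2 * (C + 1))).
have g0 : 0 < g by rewrite /g lt_min ltr01 divr_gt0 // mulr_gt0 // ltr_wpDl.
have [r r0 rP] := cont_diff_strict z FC d0.
have Gk := GS_near FC xz d0.
have dx : (fun k => x k.+1 - x k) @ \oo --> (0 : 'rV[R]_n).
  rewrite -(subrr z); apply: cvgB => //.
  by move: xz; rewrite -(cvg_shiftS x).
have nFz : 0 < `|F z| by rewrite normr_gt0.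
have Fx : (fun k => F (x k)) @ \oo --> F z.
  by apply: cvg_comp xz _; exact: differentiable_continuous (proj1 FC z).
have Flow : \forall k \near \oo, `|F z| / 2 < `|F (x k)|.
  by apply: (cvgr_norm_gt _ Fx); rewrite ltr_pdivrMr //; lra.
have dr : \forall k \near \oo, `|x k.+1 - x k| < sigma * (r / 2).
  by apply: (cvgr0_norm_lt _ dx); rewrite mulr_gt0 // divr_gt0.
have dg : \forall k \near \oo,
    `|x k.+1 - x k| < sigma * g * (beta_min * (`|F z| / 2)).
  by apply: (cvgr0_norm_lt _ dx); rewrite !mulr_gt0 // invr_gt0.
have xr : \forall k \near \oo, `|x k - z| < r / 2.
  by apply: cvgr_distC_lt; [exact: xz|rewrite divr_gt0].
near \oo => k.
have kB : condB F x rho beta k by near: k.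
have kG v : `|dot v (appmx (GS F x k) v) - dot v (appmx (Jac F z) v)| <=
    d * dot v v by move: v; near: k.
have kF : `|F z| / 2 < `|F (x k)| by near: k.
have kr : `|x k.+1 - x k| < sigma * (r / 2) by near: k.
have kg : `|x k.+1 - x k| < sigma * g * (beta_min * (`|F z| / 2)) by near: k.
have kx : `|x k - z| < r / 2 by near: k.
have /andP[bkl bku] := babs k.
have [m [before accepted]] := st k.
have stepn : `|x k.+1 - x k| = sigma ^+ m * `|beta k| * `|F (x k)|.
  have sm0 : 0 <= sigma ^+ m by rewrite exprn_ge0 // ltW.
  by have [->|->] := try_step_some accepted;
    rewrite normrZ ?normrN normrM (ger0_norm sm0).
(* The small step forces gamma_k to be small, with a factor sigma to spare: this
   excludes m = 0 and bounds the previous, rejected, value of gamma by g. *)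
have sm : sigma ^+ m < sigma * g.
  have h : 0 < beta_min * (`|F z| / 2) by rewrite mulr_gt0 // divr_gt0.
  rewrite -(ltr_pM2r h); apply: le_lt_trans kg; rewrite stepn -mulrA.
  rewrite ler_wpM2l ?exprn_ge0 ?(ltW s0) //.
  by rewrite ler_pM // ?(ltW bm0) ?(ltW kF) // divr_ge0.
have gle1 : g <= 1 by rewrite /g ge_min lexx.
case: m before accepted stepn sm => [|m] before accepted stepn sm.
  by move: sm; rewrite expr0 => sm; exfalso; nra.
have {}before := try_step_none (before m (ltnSn m)).
set gam := sigma ^+ m in before.
have gam0 : 0 < gam by rewrite exprn_gt0.
have gamg : gam < g by rewrite -(ltr_pM2l s0) -exprS.
set p := - (gam * beta k) *: F (x k) in before.
(* The rejected step is 1 / sigma times as long as the accepted one, hence also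
   small. *)
have pr : `|p| < r / 2.
  rewrite -(ltr_pM2l s0); apply: le_lt_trans kr.
  rewrite stepn /p normrZ normrN normrM (gtr0_norm gam0) exprS.
  by rewrite !mulrA.
have xpz : `|x k + p - z| < r.
  rewrite addrAC; apply: le_lt_trans (ler_normD _ _) _; lra.
have xkz : `|x k - z| < r by lra.
have pE : x k + p - x k = p by rewrite addrAC subrr add0r.
have := rP _ _ xkz xpz; rewrite pE => lin.
have N0 := dot_gt0 (Fn k).
have rho01 : 0 < rho < 1 by rewrite rho0.
have gam01 : 0 < gam <= 1 by rewrite gam0 (le_trans (ltW gamg) gle1).
have rej : (1 - rho * gam) * enorm (F (x k)) <
    enorm (F (x k) + (F (x k + p) - F (x k))).
  rewrite [F (x k) + _]addrC subrK; apply: le_lt_trans before.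
  rewrite ler_wpM2r ?enorm_ge0 // lerD2r lerDl ltW //.
have key := rejected_backward_step (Fn k) rho01 gam01 (ltW d0) lin rej.
have := rejection_condB_gap N0 (kG (F (x k))) key kB.
rewrite -/S => fin.
have h1 : 4 * d * `|beta k| <= rho / 2.
  have -> : rho / 2 = 4 * d * beta_max by rewrite /d; field; rewrite gt_eqF.
  by rewrite ler_wpM2l // mulr_ge0 // ltW.
have h2 : gam * beta k ^+ 2 * S <= rho / 2.
  have hb : beta k ^+ 2 <= beta_max ^+ 2.
    by rewrite -(real_normK (num_real (beta k))) ler_pXn2r ?nnegrE // ltW.
  apply: (@le_trans _ _ (g * C)).
    rewrite -mulrA; apply: ler_pM; rewrite ?(ltW gam0) ?(ltW gamg) //.
      by rewrite mulr_ge0 ?sqr_ge0.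
    exact: ler_wpM2r.
  apply: (@le_trans _ _ (rho / (2 * (C + 1)) * (C + 1))); last first.
    by rewrite le_eqVlt; apply/orP; left; apply/eqP; field; rewrite gt_eqF // ltr_wpDl.
  by rewrite ler_pM ?(ltW g0) // ?ge_min ?lexx ?orbT // lerDl.
lra.
Unshelve. all: by end_near.
Qed.

(** * Lower bounds for the spectral steplengths *)

Lemma dot_perturb (R : realType) (n : nat) (A : 'M[R]_n) (p y : 'rV[R]_n)
    (d : R) : enorm (y - appmx A p) <= d * enorm p ->
  `|dot p y - dot p (appmx A p)| <= d * dot p p.
Proof.
move=> e; rewrite -dotBr; apply: le_trans (cauchy_schwarz _ _) _.
by rewrite -enorm_sqr expr2 mulrCA ler_wpM2l ?enorm_ge0.
Qed.

Lemma enorm_perturb (R : realType) (n : nat) (A : 'M[R]_n) (p y : 'rV[R]_n)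
    (d : R) : enorm (y - appmx A p) <= d * enorm p ->
  enorm y <= enorm (appmx A p) + d * enorm p.
Proof.
move=> e; rewrite -[y in leLHS](subrK (appmx A p)) addrC.
by apply: le_trans (enormD _ _) _; rewrite lerD2l.
Qed.

(** The first steplength is the inverse of the Rayleigh quotient of p, which is at
    most L + d; d < mu keeps <p, y> positive. *)
Lemma bb1_lower_bound (R : realType) (n : nat) (A : 'M[R]_n)
    (p y : 'rV[R]_n) (mu L d : R) : p != 0 -> 0 < d < mu ->
  mu * dot p p <= dot p (appmx A p) <= L * dot p p ->
  enorm (y - appmx A p) <= d * enorm p ->
  (L + d)^-1 <= dot p p / dot p y.
Proof.
move=> p0 /andP[d0 dmu] /andP[lo hi] /dot_perturb.
have q0 := dot_gt0 p0.
rewrite ler_distl => /andP[h1 h2].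
have py0 : 0 < dot p y by nra.
have Ld0 : 0 < L + d by nra.
rewrite ler_pdivlMr // ler_pdivrMl //; lra.
Qed.

(** The second steplength is bounded by <p, y> >= (mu - d) |p|^2 and
    |y| <= (|A| + d) |p|. *)
Lemma bb2_lower_bound (R : realType) (n : nat) (A : 'M[R]_n)
    (p y : 'rV[R]_n) (mu d : R) : p != 0 -> 0 < d < mu ->
  mu * dot p p <= dot p (appmx A p) ->
  enorm (y - appmx A p) <= d * enorm p ->
  (mu - d) / (norm2_mx A + d) ^+ 2 <= dot p y / dot y y.
Proof.
move=> p0 /andP[d0 dmu] lo ye; have q0 := dot_gt0 p0.
have := dot_perturb ye; rewrite ler_distl => /andP[h1 h2].
have py0 : 0 < dot p y by nra.
have y0 : y != 0 by apply: contraTneq py0 => ->; rewrite dot0r ltxx.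
have yn : enorm y <= (norm2_mx A + d) * enorm p.
  by rewrite mulrDl; apply: le_trans (enorm_perturb ye) _;
    rewrite lerD2r enorm_appmx_norm2.
have Sd0 : 0 < norm2_mx A + d.
  by rewrite -(pmulr_lgt0 _ (enorm_gt0 p0)); apply: lt_le_trans yn; exact: enorm_gt0.
have yy : dot y y <= (norm2_mx A + d) ^+ 2 * dot p p.
  by rewrite -!enorm_sqr -exprMn ler_pXn2r ?nnegrE ?mulr_ge0 ?enorm_ge0 // ltW.
rewrite ler_pdivlMr ?dot_gt0 // mulrAC ler_pdivrMr ?exprn_gt0 //.
apply: (@le_trans _ _ ((mu - d) * ((norm2_mx A + d) ^+ 2 * dot p p))).
  by rewrite ler_wpM2l // subr_ge0 ltW.
rewrite mulrCA mulrC ler_wpM2r ?sqr_ge0 //; lra.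
Qed.

(** For a symmetric matrix |A p|^2 <= |A| <p, A p>, so |y|^2 is compared with <p, y>
    directly, and only the error terms go through |p|^2 <= <p, y> / (mu - d). *)
Lemma bb2_sym_lower_bound (R : realType) (n : nat) (A : 'M[R]_n)
    (p y : 'rV[R]_n) (mu d : R) : A^T = A -> posdef A ->
  p != 0 -> 0 < d < mu ->
  mu * dot p p <= dot p (appmx A p) ->
  enorm (y - appmx A p) <= d * enorm p ->
  (norm2_mx A + (3 * norm2_mx A * d + d ^+ 2) / (mu - d))^-1 <=
  dot p y / dot y y.
Proof.
move=> At Apd p0 /andP[d0 dmu] lo ye; have q0 := dot_gt0 p0.
have := dot_perturb ye; rewrite ler_distl => /andP[h1 h2].
have py0 : 0 < dot p y by nra.
have y0 : y != 0 by apply: contraTneq py0 => ->; rewrite dot0r ltxx.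
have AA := sqr_enorm_appmx_le p At Apd.
have hi := dot_appmx_le_norm2 A p.
set L := norm2_mx A in AA hi *.
have L0 : 0 < L by nra.
have nA : enorm (appmx A p) <= L * enorm p := enorm_appmx_norm2 A p.
have yy : dot y y <= L * dot p (appmx A p) + (2 * L * d + d ^+ 2) * dot p p.
  apply: le_trans (_ : (enorm (appmx A p) + d * enorm p) ^+ 2 <= _).
    by rewrite -enorm_sqr ler_pXn2r ?nnegrE ?addr_ge0 ?mulr_ge0 ?enorm_ge0
      ?(ltW d0) // enorm_perturb.
  have ep := enorm_ge0 p.
  have : d * enorm p * enorm (appmx A p) <= d * enorm p * (L * enorm p).
    by rewrite ler_wpM2l // mulr_ge0 // ltW.
  rewrite sqrrD enorm_sqr -enorm_sqr; move: AA; rewrite -!enorm_sqr.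
  move: (enorm p) (enorm (appmx A p)) (dot p _) => u v w; lra.
have K0 : 0 <= 3 * L * d + d ^+ 2 by rewrite addr_ge0 ?sqr_ge0 // !mulr_ge0 // ltW.
have pp : dot p p <= dot p y / (mu - d).
  rewrite ler_pdivlMr ?subr_gt0 //; lra.
have fin : dot y y <= (L + (3 * L * d + d ^+ 2) / (mu - d)) * dot p y.
  apply: (@le_trans _ _ (L * dot p y + (3 * L * d + d ^+ 2) * dot p p)).
    have : L * dot p (appmx A p) <= L * (dot p y + d * dot p p).
      by rewrite ler_pM2l //; lra.
    lra.
  rewrite [leRHS]mulrDl lerD2l; apply: le_trans (ler_wpM2l K0 pp) _.
  by rewrite mulrA mulrAC.
rewrite ler_pdivlMr ?dot_gt0 // ler_pdivrMl //.
by rewrite ltr_wpDr // divr_ge0 // subr_ge0 ltW.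
Qed.

(** * Sufficient conditions for the Rayleigh quotient inequality *)

Lemma exists_small_gt (R : realType) (h : R -> R) (mu a : R) :
  0 < mu -> {for 0, continuous h} -> a < h 0 ->
  exists2 d : R, 0 < d < mu & a < h d.
Proof.
move=> mu0 hc ah.
have hr : h d @[d --> 0^'+] --> h 0 by exact: cvg_at_right_filter.
near (0 : R)^'+ => d; exists d.
  by apply/andP; split; near: d; [exact: nbhs_right_gt|exact: nbhs_right_lt].
by near: d; exact: (cvgr_gt _ hr).
Unshelve. all: by end_near.
Qed.

(** The hypothesis P carries the rule by which the steplength was chosen at step k,
    so that a rule may be used even if it does not hold at all late steps. *)
Lemma condB_of_lower_bound (R : realType) (n : nat)
    (F : 'rV[R]_n -> 'rV[R]_n) (z : 'rV[R]_n) (x : nat -> 'rV[R]_n)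
    (rho d mu g : R) (beta : nat -> R) (P : nat -> Prop) :
  cont_diff F -> x @ \oo --> z -> (forall k, F (x k) != 0) ->
  (forall v, mu * dot v v <= dot v (appmx (Jac F z) v)) ->
  0 < d < mu -> 0 < g -> 3 / 2 * rho < g * (mu - d) ->
  (\forall k \near \oo, P k -> g <= beta k) ->
  \forall k \near \oo, P k -> condB F x rho beta k.
Proof.
move=> FC xz Fn lo /andP[d0 dmu] g0 gr Pg.
have Gk := GS_near FC xz d0.
near=> k => Pk; rewrite /condB /rayleigh.
have gk : g <= beta k by move: Pk; near: k.
have N0 := dot_gt0 (Fn k).
have := lo (F (x k)).
have : `|dot (F (x k)) (appmx (GS F x k) (F (x k))) -
    dot (F (x k)) (appmx (Jac F z) (F (x k)))| <= d * dot (F (x k)) (F (x k)).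
  by move: (F (x k)); near: k.
rewrite ler_distl => /andP[h1 h2] h3.
apply: lt_le_trans gr _; apply: ler_pM => //; first exact: ltW.
  by rewrite subr_ge0 ltW.
rewrite ler_pdivlMr //; lra.
Unshelve. all: by end_near.
Qed.

Lemma secant_near (R : realType) (n : nat) (F : 'rV[R]_n -> 'rV[R]_n)
    (z : 'rV[R]_n) (x : nat -> 'rV[R]_n) (d : R) :
  cont_diff F -> x @ \oo --> z -> 0 < d ->
  \forall k \near \oo, enorm (F (x k) - F (x k.-1) -
    appmx (Jac F z) (x k - x k.-1)) <= d * enorm (x k - x k.-1).
Proof.
move=> FC xz d0; have [r r0 rP] := cont_diff_strict z FC d0.
have [N _ xr] : \forall k \near \oo, `|x k - z| < r.
  by apply: cvgr_distC_lt; [exact: xz|].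
exists N.+1 => // -[//|k] /= Nk.
by apply: rP; apply: xr => //=; exact: leqW.
Qed.

(** The function g bounds the steplength b p y from below in terms of the relative
    error d of the linearization of the secant pair. By continuity the strict
    inequality at d = 0 survives for some d > 0. *)
Lemma condB_of_secant_bound (R : realType) (n : nat)
    (F : 'rV[R]_n -> 'rV[R]_n) (z : 'rV[R]_n)
    (rho sigma beta_min beta_max eta mu : R) (eta_ beta : nat -> R)
    (x : nat -> 'rV[R]_n) (b : 'rV[R]_n -> 'rV[R]_n -> R) (g : R -> R) :
  cont_diff F -> SRAND_run F rho sigma beta_min beta_max eta eta_ beta x ->
  x @ \oo --> z -> 0 < mu ->
  (forall v, mu * dot v v <= dot v (appmx (Jac F z) v)) ->
  {for 0, continuous g} -> (forall d, 0 < d < mu -> 0 < g d) ->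
  (forall d p y, 0 < d < mu -> p != 0 ->
     enorm (y - appmx (Jac F z) p) <= d * enorm p -> g d <= b p y) ->
  3 / 2 * rho < g 0 * mu ->
  \forall k \near \oo,
    beta k = b (x k - x k.-1) (F (x k) - F (x k.-1)) -> condB F x rho beta k.
Proof.
move=> FC run xz mu0 lo gc g0 gb grho.
have [d d0mu hd] : exists2 d, 0 < d < mu & 3 / 2 * rho < g d * (mu - d).
  apply: (@exists_small_gt R (fun d => g d * (mu - d))); rewrite ?subr0 //.
  by apply: cvgM; [exact: gc|apply: cvgB; [exact: cvg_cst|exact: cvg_id]].
have d0 : 0 < d by case/andP: d0mu.
have sec := secant_near FC xz d0.
apply: (condB_of_lower_bound FC xz (srand_nonstop run) lo d0mu (g0 d d0mu) hd).
near=> k => ->; apply: gb => //; last by near: k.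
(* At k = 0 the secant pair is trivial, because 0.-1 = 0. *)
have k0 : (0 < k)%N by near: k; exists 1%N.
by rewrite -[in x k](prednK k0) (srand_step_neq0 _ run).
Unshelve. all: by end_near.
Qed.

Lemma posdef_norm2_gt0 (R : realType) (n : nat) (A : 'M[R]_n) (v : 'rV[R]_n) :
  v != 0 -> posdef A -> 0 < norm2_mx A.
Proof.
move=> v0 Apd; have := lt_le_trans (Apd v v0) (dot_appmx_le_norm2 A v).
by rewrite pmulr_lgt0 // dot_gt0.
Qed.

Lemma posdef_norm2_inv_gt0 (R : realType) (n : nat) (A : 'M[R]_n)
    (v : 'rV[R]_n) : v != 0 -> A^T = A -> posdef A -> 0 < norm2_mx (invmx A).
Proof.
move=> v0 At Apd; have := posdef_ge_norm2_inv v At Apd.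
by move=> /(lt_le_trans (dot_gt0 v0)); rewrite pmulr_lgt0 // Apd.
Qed.

Lemma posdef_inv_norm2_le (R : realType) (n : nat) (A : 'M[R]_n)
    (v : 'rV[R]_n) : A^T = A -> posdef A ->
  (norm2_mx (invmx A))^-1 * dot v v <= dot v (appmx A v).
Proof.
have [->|v0] := eqVneq v 0; first by rewrite dot0r mulr0 /appmx mul0mx dot0r.
move=> At Apd; rewrite ler_pdivrMl ?(posdef_norm2_inv_gt0 v0) //.
exact: posdef_ge_norm2_inv.
Qed.

Lemma condB_bb1 (R : realType) (n : nat) (F : 'rV[R]_n -> 'rV[R]_n)
    (z : 'rV[R]_n) (rho sigma beta_min beta_max eta mu L : R)
    (eta_ beta : nat -> R) (x : nat -> 'rV[R]_n) :
  cont_diff F -> SRAND_run F rho sigma beta_min beta_max eta eta_ beta x ->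
  x @ \oo --> z -> 0 < mu ->
  (forall v, mu * dot v v <= dot v (appmx (Jac F z) v)) ->
  0 < L ->
  (forall v, dot v (appmx (Jac F z) v) <= L * dot v v) ->
  3 / 2 * rho < L^-1 * mu ->
  \forall k \near \oo, beta k = bb1 F x k -> condB F x rho beta k.
Proof.
move=> FC run xz mu0 lo L0 hi Lrho.
apply: (condB_of_secant_bound (b := fun p y => dot p p / dot p y)
  (g := fun d => (L + d)^-1) FC run xz mu0 lo); rewrite ?addr0 //.
- apply: cvgV; first by rewrite addr0 gt_eqF.
  by apply: cvgD; [exact: cvg_cst|exact: cvg_id].
- by move=> d /andP[d0 _]; rewrite invr_gt0 addr_gt0.
- move=> d p y dmu p0; apply: (bb1_lower_bound p0 dmu).
  by rewrite lo hi.
Qed.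

Lemma condB_bb2 (R : realType) (n : nat) (F : 'rV[R]_n -> 'rV[R]_n)
    (z : 'rV[R]_n) (rho sigma beta_min beta_max eta mu : R)
    (eta_ beta : nat -> R) (x : nat -> 'rV[R]_n) :
  cont_diff F -> SRAND_run F rho sigma beta_min beta_max eta eta_ beta x ->
  x @ \oo --> z -> 0 < mu ->
  (forall v, mu * dot v v <= dot v (appmx (Jac F z) v)) ->
  0 < norm2_mx (Jac F z) ->
  3 / 2 * rho < mu ^+ 2 / norm2_mx (Jac F z) ^+ 2 ->
  \forall k \near \oo, beta k = bb2 F x k -> condB F x rho beta k.
Proof.
move=> FC run xz mu0 lo; set S := norm2_mx _ => S0 Srho.
apply: (condB_of_secant_bound (b := fun p y => dot p y / dot y y)
  (g := fun d => (mu - d) / (S + d) ^+ 2) FC run xz mu0 lo).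
- apply: cvgM; first by apply: cvgB; [exact: cvg_cst|exact: cvg_id].
  apply: cvgV; first by rewrite addr0 gt_eqF // exprn_gt0.
  by rewrite expr2; apply: cvgM; apply: cvgD;
    [exact: cvg_cst|exact: cvg_id|exact: cvg_cst|exact: cvg_id].
- by move=> d /andP[d0 dmu]; rewrite divr_gt0 ?subr_gt0 ?exprn_gt0 ?addr_gt0.
- by move=> d p y dmu p0; apply: (bb2_lower_bound p0 dmu).
- by rewrite subr0 addr0 [ltRHS]mulrAC -expr2.
Qed.

Lemma condB_bb2_sym (R : realType) (n : nat) (F : 'rV[R]_n -> 'rV[R]_n)
    (z : 'rV[R]_n) (rho sigma beta_min beta_max eta mu : R)
    (eta_ beta : nat -> R) (x : nat -> 'rV[R]_n) :
  cont_diff F -> SRAND_run F rho sigma beta_min beta_max eta eta_ beta x ->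
  x @ \oo --> z -> 0 < mu ->
  (forall v, mu * dot v v <= dot v (appmx (Jac F z) v)) ->
  (Jac F z)^T = Jac F z -> posdef (Jac F z) ->
  0 < norm2_mx (Jac F z) -> 3 / 2 * rho < (norm2_mx (Jac F z))^-1 * mu ->
  \forall k \near \oo, beta k = bb2 F x k -> condB F x rho beta k.
Proof.
move=> FC run xz mu0 lo Jt Jpd; set L := norm2_mx _ => L0 Lrho.
apply: (condB_of_secant_bound (b := fun p y => dot p y / dot y y)
  (g := fun d => (L + (3 * L * d + d ^+ 2) / (mu - d))^-1) FC run xz mu0 lo).
- apply: cvgV; first by rewrite mulr0 expr0n addr0 mul0r addr0 gt_eqF.
  apply: cvgD; first exact: cvg_cst.
  apply: cvgM.
    apply: cvgD; first by apply: cvgMr; exact: cvg_id.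
    by apply: cvgM; exact: cvg_id.
  apply: cvgV; first by rewrite subr0 gt_eqF.
  by apply: cvgB; [exact: cvg_cst|exact: cvg_id].
- move=> d /andP[d0 dmu]; rewrite invr_gt0 ltr_wpDr // divr_ge0 ?subr_ge0 ?(ltW dmu) //.
  by rewrite addr_ge0 ?sqr_ge0 // !mulr_ge0 // ltW.
- by move=> d p y dmu p0; apply: (bb2_sym_lower_bound Jt Jpd p0 dmu).
- by rewrite mulr0 expr0n addr0 mul0r addr0.
Qed.

Lemma near_imply (P Q : nat -> Prop) :
  (\forall k \near \oo, P k) -> (\forall k \near \oo, P k -> Q k) ->
  \forall k \near \oo, Q k.
Proof. by move=> hP hQ; apply: filterS2 hP hQ => k Pk; exact. Qed.

(** Here L and N are the norms of a matrix and of its inverse. *)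
Lemma cond_bound_inv (R : realType) (L N rho w : R) :
  0 < L -> 0 < N -> 0 < rho -> w < 1 -> L * N < 2 * w / (3 * rho) ->
  3 / 2 * rho < L^-1 * N^-1.
Proof.
move=> L0 N0 r0 w1; rewrite ltr_pdivlMr ?mulr_gt0 // => h.
rewrite -invfM -[ltRHS]mul1r ltr_pdivlMr ?mulr_gt0 //; lra.
Qed.

Theorem theorem5p3 (R : realType) (n : nat) (F : 'rV[R]_n -> 'rV[R]_n)
    (xstar : 'rV[R]_n)
    (F_C1 : cont_diff F)
    (JS_posdef : posdef (JacS F xstar)) :
  (forall (rho sigma beta_min beta_max eta : R) (eta_ beta : nat -> R)
      (x : nat -> 'rV[R]_n),
    SRAND_run F rho sigma beta_min beta_max eta eta_ beta x ->
    x @ \oo --> xstar ->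
    (forall eps nu : R, 0 < eps < 1 -> 0 < nu ->
       (\forall k \near \oo, condA F rho eps nu xstar beta k) ->
       (\forall k \near \oo, condB F x rho beta k) ->
       F xstar = 0) /\
    ((\forall k \near \oo, beta k = bb1 F x k \/ beta k = bb2 F x k) ->
     (\forall k \near \oo, condB F x rho beta k) ->
     F xstar = 0))
  /\
  (exists omega2 : R, 0 < omega2 < 1 /\
   forall omega1 : R, 0 < omega1 < 1 ->
   forall (rho sigma beta_min beta_max eta : R) (eta_ beta : nat -> R)
      (x : nat -> 'rV[R]_n),
    SRAND_run F rho sigma beta_min beta_max eta eta_ beta x ->
    x @ \oo --> xstar ->
    [/\ (\forall k \near \oo, beta k = bb1 F x k) ->
        cond2 (JacS F xstar) < 2 * omega1 / (3 * rho) ->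
        \forall k \near \oo, condB F x rho beta k,
        (\forall k \near \oo, beta k = bb2 F x k) ->
        cond2 (JacS F xstar) < omega2 * Num.sqrt (2 / (3 * rho)) ->
        \forall k \near \oo, condB F x rho beta k &
        (forall z : 'rV[R]_n, (Jac F z)^T = Jac F z) ->
        (\forall k \near \oo, beta k = bb1 F x k \/ beta k = bb2 F x k) ->
        cond2 (Jac F xstar) < 2 * omega1 / (3 * rho) ->
        \forall k \near \oo, condB F x rho beta k]).
Proof.
split=> [rho sigma beta_min beta_max eta eta_ beta x run xz|].
  by split=> [eps nu _ _ _|_]; exact: srand_limit_zero F_C1 run xz.
set J := Jac F xstar; set A := JacS F xstar in JS_posdef *.
have At : A^T = A := sym_part_tr J.
have AJ v : dot v (appmx A v) = dot v (appmx J v) := dot_sym_part J v.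
have J_posdef : posdef J.
  by move=> u u0; rewrite -AJ; exact: JS_posdef.
pose c := norm2_mx A / norm2_mx J.
(* The condition on omega2 is meant to replace |A| by |J|, whence omega2 <= c. The
   default value only serves n = 0, where both norms vanish. *)
pose w2 : R := if 0 < c then Num.min (1 / 2) c else 1 / 2.
exists w2; split.
  rewrite /w2; case: ifPn => c0; last by apply/andP; split; lra.
  by rewrite lt_min gt_min c0 andbT; apply/andP; split; [lra|apply/orP; left; lra].
move=> w1 /andP[_ w11] rho sigma beta_min beta_max eta eta_ beta x run xz.
have Fx0 := srand_nonstop run 0.
have /andP[rho0 _] := srand_rho run.
have L0 : 0 < norm2_mx A by exact: posdef_norm2_gt0 Fx0 JS_posdef.
have S0 : 0 < norm2_mx J by exact: posdef_norm2_gt0 Fx0 J_posdef.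
have N0 : 0 < norm2_mx (invmx A) by exact: posdef_norm2_inv_gt0 Fx0 At JS_posdef.
have mu0 : 0 < (norm2_mx (invmx A))^-1 by rewrite invr_gt0.
have lo v : (norm2_mx (invmx A))^-1 * dot v v <= dot v (appmx J v).
  by rewrite -AJ; exact: posdef_inv_norm2_le.
have hi v : dot v (appmx J v) <= norm2_mx A * dot v v.
  by rewrite -AJ; exact: dot_appmx_le_norm2.
have case1 := condB_bb1 F_C1 run xz mu0 lo L0 hi.
split.
- move=> hb /(cond_bound_inv L0 N0 rho0 w11) /case1.
  exact: near_imply.
- move=> hb hc; apply: near_imply hb _.
  apply: (condB_bb2 F_C1 run xz mu0 lo S0).
  have c0 : 0 < c by rewrite divr_gt0.
  have w2c : w2 <= c by rewrite /w2 c0 ge_min lexx orbT.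
  have q0 : 0 <= 2 / (3 * rho) by rewrite divr_ge0 // mulr_ge0 // ltW.
  have h : norm2_mx (invmx A) * norm2_mx J < Num.sqrt (2 / (3 * rho)).
    have c1 : c * norm2_mx J = norm2_mx A by rewrite divfK // gt_eqF.
    rewrite -(ltr_pM2l c0).
    have -> : c * (norm2_mx (invmx A) * norm2_mx J) = cond2 A.
      by rewrite /cond2 -c1; ring.
    by apply: lt_le_trans hc _; rewrite ler_wpM2r // sqrtr_ge0.
  have h2 : (norm2_mx (invmx A) * norm2_mx J) ^+ 2 < 2 / (3 * rho).
    rewrite -[ltRHS]sqr_sqrtr // ltr_pXn2r ?nnegrE ?sqrtr_ge0 //.
    by rewrite mulr_ge0 // ltW.
  rewrite exprVn -invfM -exprMn -[ltRHS]mul1r ltr_pdivlMr ?exprn_gt0 ?mulr_gt0 //.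
  move: h2; rewrite ltr_pdivlMr ?mulr_gt0 //; lra.
- move=> Jt hb hc.
  have JA : A = J by exact: sym_part_id (Jt xstar).
  rewrite -/J -JA in hc.
  have hr := cond_bound_inv L0 N0 rho0 w11 hc.
  have case2 : \forall k \near \oo, beta k = bb2 F x k -> condB F x rho beta k.
    apply: (condB_bb2_sym F_C1 run xz mu0 lo (Jt xstar)) => //; rewrite -/J -JA //.
  have {}case1 := case1 hr.
  near=> k; have [e|e] : beta k = bb1 F x k \/ beta k = bb2 F x k by near: k.
    by move: e; near: k.
  by move: e; near: k.
Unshelve. all: by end_near.
Qed.
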